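(* Let $X$ be a metric space equipped with an isometric action by a compact group $G$, and let $\phi\colon X\to H$ be a map into a Hilbert space $H$. Equip $G$ with its unique normalized bi-invariant Haar measure, and let $L^2(G,H)$ be the associated Hilbert space with its $G$-action (defined in the context). Then there exists a map $\psi\colon X\to L^2(G,H)$ such that (a) $\psi$ is $G$-equivariant, i.e., $\psi\circ g=g\circ\psi$ for each $g\in G$, and (b) $\kappa(\psi)\leq\kappa(\phi)$.
   Context: For a map $f\colon X\to Y$ of metric spaces, let $\alpha,\beta\in[0,\infty]$ be the largest and smallest constants (respectively) with $\alpha\, d_X(x,x')\le d_Y(f(x),f(x'))\le\beta\, d_X(x,x')$ for all $x,x'\in X$; the distortion of $f$ is $\kappa(f):=\beta/\alpha$, where $\kappa(f)=\infty$ if $\alpha=0$ or $\beta=\infty$. For a compact group $G$ with Haar measure $\mu$ on its Borel $\sigma$-algebra and a Hilbert space $H$, $L^2(G,H)$ is the Hilbert space of Borel-measurable functions $f\colon G\to H$ with $\int_G\|f(g)\|_H^2\,d\mu(g)<\infty$, with functions identified if they agree $\mu$-almost everywhere, under the inner product $\langle f_1,f_2\rangle=\int_G\langle f_1(g),f_2(g)\rangle_H\,d\mu(g)$. The group $G$ acts unitarily on $L^2(G,H)$ by $(g\cdot f)(h)=f(hg)$. In (a), each $g\in G$ is interpreted as the function by which it acts on $X$ and on $L^2(G,H)$, respectively.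
   Formalization: The isometric action of the compact group is assumed to be continuous (jointly in the group element and the point); without continuity the claim fails, e.g. for the circle translating itself with the discrete metric. *)

(* Defs.v *)
From HB Require Import structures.
From mathcomp Require Import all_boot all_order all_algebra.
From mathcomp Require Import sesquilinear.
From mathcomp Require Import all_classical all_reals all_analysis.
From mathcomp Require Import measurable_realfun.
From mathcomp.real_closed Require Import complex.

Set Implicit Arguments.
Unset Strict Implicit.
Unset Printing Implicit Defensive.

Import Order.TTheory GRing.Theory Num.Theory.
Import numFieldNormedType.Exports.
Local Open Scope classical_set_scope.
Local Open Scope ring_scope.

(** * Distortion *)

(* The distances are explicit functions, since the norm of a complex Hilbert
   space takes its values in R[i] and not in R.  By convention +oo * 0 = 0 in
   \bar R, so that the lower constant of a map on a one-point (or empty) space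
   is +oo, its upper constant is 0 and its distortion is 0. *)
Section Distortion.
Context {R : realType} {X Y : Type}.
Variables (dX : X -> X -> R) (dY : Y -> Y -> R) (f : X -> Y).
Local Open Scope ereal_scope.

Definition is_lower_constant (a : \bar R) :=
  0 <= a /\ forall x x', a * (dX x x')%:E <= (dY (f x) (f x'))%:E.

Definition is_upper_constant (b : \bar R) :=
  0 <= b /\ forall x x', (dY (f x) (f x'))%:E <= b * (dX x x')%:E.

(* The supremum and infimum are attained: see lower_constantP and
   upper_constantP below. *)
Definition lower_constant : \bar R := ereal_sup is_lower_constant.
Definition upper_constant : \bar R := ereal_inf is_upper_constant.

Definition distortion : \bar R :=
  if (lower_constant == 0) || (upper_constant == +oo) then +oo
  else upper_constant / lower_constant.

Hypothesis dX_ge0 : forall x x', (0 <= dX x x')%R.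
Hypothesis dY_ge0 : forall y y', (0 <= dY y y')%R.

Lemma lower_constantP : is_lower_constant lower_constant.
Proof.
have a0 : 0 <= lower_constant.
  apply: ereal_sup_ubound; split => // x x'.
  by rewrite mul0e lee_fin.
split=> // x x'; have := dX_ge0 x x'.
rewrite le_eqVlt => /orP[/eqP <-|d0]; first by rewrite mule0 lee_fin.
rewrite -lee_pdivlMr//; apply: ge_ereal_sup => a [_ /(_ x x')].
by rewrite lee_pdivlMr.
Qed.

Lemma upper_constantP : (forall x x', dX x x' = 0%R -> f x = f x') ->
  (forall y, dY y y = 0%R) -> is_upper_constant upper_constant.
Proof.
move=> sep d0; split; first by apply: le_ereal_inf_tmp => b [].
move=> x x'; have := dX_ge0 x x'.
rewrite le_eqVlt => /orP[/eqP/esym dx|dx].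
  by rewrite (sep _ _ dx) d0 dx mule0.
rewrite -lee_pdivrMr//; apply: le_ereal_inf_tmp => b [_ /(_ x x')].
by rewrite lee_pdivrMr.
Qed.

End Distortion.

(** * Real and complex Hilbert spaces *)

Variant scalar_kind := Reals | Complexes.

Definition scalars (R : realType) (k : scalar_kind) : numFieldType :=
  match k with Reals => R | Complexes => R[i] end.

Section Scalars.
Variable R : realType.

Definition scalar_re (k : scalar_kind) : scalars R k -> R :=
  match k return scalars R k -> R with
  | Reals => fun x => x
  | Complexes => @complex.Re R
  end.

Definition scalar_conj (k : scalar_kind) : scalars R k -> scalars R k :=
  match k return scalars R k -> scalars R k with
  | Reals => fun x => x
  | Complexes => @conjc R
  end.

Definition scalar_integral (k : scalar_kind) d (T : measurableType d)
    (mu : {measure set T -> \bar R}) : (T -> scalars R k) -> scalars R k :=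
  match k return (T -> scalars R k) -> scalars R k with
  | Reals => fun f => \int[mu]_x f x
  | Complexes => fun f =>
      Complex (\int[mu]_x complex.Re (f x)) (\int[mu]_x complex.Im (f x))
  end.

End Scalars.

(* The inner product is linear in its first argument. *)
HB.mixin Record CompleteNormedModule_isHilbert (R : realType) (k : scalar_kind)
    (H : Type) of CompleteNormedModule (scalars R k) H := {
  inner : {dot H for @scalar_conj R k} ;
  inner_normE : forall v : H, inner v v = `|v| ^+ 2
}.

#[short(type="hilbertType")]
HB.structure Definition Hilbert (R : realType) (k : scalar_kind) :=
  {H of CompleteNormedModule (scalars R k) H
      & CompleteNormedModule_isHilbert R k H}.

(* `|v| is a nonnegative element of [scalars R k]; [hnorm v] is the
   corresponding element of R. *)
Definition hnorm {R : realType} {k : scalar_kind} {H : hilbertType R k}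
  (v : H) : R := scalar_re `|v|.

Definition hdist {R : realType} {k : scalar_kind} {H : hilbertType R k}
  (u v : H) : R := hnorm (u - v).

Section HnormContinuity.
Variable R : realType.

Lemma scalar_re_ge0 k (x : scalars R k) : 0 <= x -> 0 <= scalar_re x.
Proof. by case: k x => //= x; rewrite lecE => /andP[]. Qed.

Lemma hnorm_ge0 k (H : hilbertType R k) (v : H) : 0 <= hnorm v.
Proof. exact/scalar_re_ge0/normr_ge0. Qed.

Lemma hnorm_continuous k (H : hilbertType R k) :
  continuous (@hnorm R k H : H -> R).
Proof.
move=> v; apply/cvgrPdist_lt => e e0.
have [d d0 re_lt] : exists2 d : scalars R k, 0 < d &
    forall x y : scalars R k, `|x - y| < d -> `|scalar_re x - scalar_re y| < e.
  case: k {H v} => /=; first by exists e.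
  exists (e%:C)%C => [|[a b] [a' b']]; rewrite ltcE/=; first by rewrite eqxx.
  move=> /andP[_]; apply: le_lt_trans.
  by rewrite -[leLHS]sqrtr_sqr ler_wsqrtr// lerDl sqr_ge0.
have /cvgrPdist_lt/(_ _ d0) := @norm_continuous _ H v.
by apply: filterS => w; exact: re_lt.
Qed.

End HnormContinuity.

(** * Compact groups, Haar measure and isometric actions *)

(* The base point is irrelevant; it is present because measurable types are
   pointed. *)
HB.mixin Record isTopologicalGroup (G : Type)
    of PointedTopological G & Group G := {
  mulg_continuous : continuous (fun p : G * G => (p.1 * p.2)%g) ;
  invg_continuous : continuous (fun g : G => (g^-1)%g)
}.

#[short(type="topologicalGroupType")]
HB.structure Definition TopologicalGroup :=
  {G of PointedTopological G & Group G & isTopologicalGroup G}.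

HB.mixin Record isCompactHausdorff (G : Type) of Topological G := {
  compact_setT : compact [set: G] ;
  hausdorffT : hausdorff_space G
}.

#[short(type="compactGroupType")]
HB.structure Definition CompactGroup :=
  {G of TopologicalGroup G & isCompactHausdorff G}.

Notation borel T := (g_sigma_algebraType (@open T)).

Lemma continuous_borel_measurable (S T : ptopologicalType) (f : S -> T) :
  continuous f -> measurable_fun [set: borel S] (f : borel S -> borel T).
Proof.
move=> /continuousP cf.
apply: (@measurability _ _ (borel S) (borel T) setT f (@open T)) => //.
by move=> _ [U oU <-]; rewrite setTI; apply: sub_sigma_algebra; exact: cf.
Qed.

Lemma continuous_real_measurable (R : realType) (S : ptopologicalType)
  (f : S -> R) : continuous f -> measurable_fun [set: borel S] (f : borel S -> R).
Proof.
move=> /continuousP cf; apply: (measurability _ (RGenOpens.measurableE R)).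
move=> _ [_ [a [b ->]] <-]; rewrite setTI; apply: sub_sigma_algebra.
by apply: cf; exact: interval_open.
Qed.

(* The normalized bi-invariant regular Borel measure on G. *)
Record haar_measure (R : realType) (G : compactGroupType) := HaarMeasure {
  haar :> probability (borel G) R ;
  haar_left_invariant : forall (g : G) (A : set (borel G)),
    measurable A -> haar [set (g * h)%g | h in A] = haar A ;
  haar_right_invariant : forall (g : G) (A : set (borel G)),
    measurable A -> haar [set (h * g)%g | h in A] = haar A ;
  haar_outer_regular : forall A : set (borel G), measurable A ->
    haar A = ereal_inf [set haar U | U in [set U : set G | open U /\ A `<=` U]] ;
  haar_inner_regular : forall A : set (borel G), measurable A ->
    haar A = ereal_sup [set haar K | K in [set K : set G | compact K /\ K `<=` A]]
}.

(* Continuity is part of the notion of an action of a topological group: for G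
   acting on itself with the discrete metric, no equivariant map into
   L^2(G, H) need be bilipschitz. *)
Record isometric_action (R : realType) (G : topologicalGroupType)
    (X : metricType R) := IsometricAction {
  act :> G -> X -> X ;
  act1 : forall x, act 1%g x = x ;
  actM : forall g h x, act (g * h)%g x = act g (act h x) ;
  act_isometry : forall g x y, mdist (act g x) (act g y) = mdist x y ;
  act_continuous : continuous (fun p : G * X => act p.1 p.2)
}.

(** * The Hilbert space L^2(G, H) *)

(* No measurability of f1 and f2 is required: the sum of two Borel maps into a
   nonseparable Hilbert space need not be Borel. *)
Section AeEqIntegral.
Import HBNNSimple.
Context d (T : measurableType d) (R : realType) (mu : {measure set T -> \bar R}).
Local Open Scope ereal_scope.

Lemma ge0_ae_eq_integral_nonmeasurable (f1 f2 : T -> \bar R) :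
  (forall x, 0 <= f1 x) -> (forall x, 0 <= f2 x) ->
  {ae mu, forall x, f1 x = f2 x} -> \int[mu]_x f1 x = \int[mu]_x f2 x.
Proof.
wlog suff le : f1 f2 / (forall x, 0 <= f1 x) -> (forall x, 0 <= f2 x) ->
    {ae mu, forall x, f1 x = f2 x} -> \int[mu]_x f1 x <= \int[mu]_x f2 x.
  move=> f10 f20 e; apply/eqP; rewrite eq_le !le//.
  by apply: filterS e => x ->.
move=> f10 f20 [N [mN N0 subN]].
rewrite [leLHS]ge0_integralTE//; apply: ge_ereal_sup => _ [h /= hf1 <-].
rewrite -integralT_nnsfun (ge0_negligible_integral mN)//; last 2 first.
- exact/measurable_EFinP.
- by move=> x _; rewrite lee_fin.
have mNC : measurable (~` N) by exact: measurableC.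
rewrite setTD integral_mkcond.
rewrite (_ : _ \_ _ = EFin \o proj_nnsfun h mNC); last first.
  apply/funext => x /=; rewrite patchE mindicE.
  by case: ifPn => _; rewrite ?mulr1 ?mulr0.
rewrite [X in X <= _]integralT_nnsfun ge0_integralTE//.
apply: ereal_sup_ubound; exists (proj_nnsfun h mNC) => //= x.
rewrite mindicE; case: (boolP (x \in ~` N)) => [|_]; last by rewrite mulr0.
rewrite inE mulr1 => Nx; rewrite (le_trans (hf1 x))// le_eqVlt.
by apply/orP; left; apply/eqP; apply: contrapT => f12; apply/Nx/subN.
Qed.

Lemma ae_eq_integral_nonmeasurable (f1 f2 : T -> \bar R) :
  {ae mu, forall x, f1 x = f2 x} -> \int[mu]_x f1 x = \int[mu]_x f2 x.
Proof.
move=> e; rewrite integralE [RHS]integralE; congr (_ - _);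
  by apply: ge0_ae_eq_integral_nonmeasurable => //; apply: filterS e => x;
    rewrite ?funeposE ?funenegE => ->.
Qed.

Lemma ae_eq_Rintegral_nonmeasurable (f1 f2 : T -> R) :
  {ae mu, forall x, f1 x = f2 x} -> (\int[mu]_x f1 x = \int[mu]_x f2 x)%R.
Proof.
move=> e; rewrite /Rintegral; congr fine; apply: ae_eq_integral_nonmeasurable.
by apply: filterS e => x ->.
Qed.

Lemma ae_eq_scalar_integral k (f1 f2 : T -> scalars R k) :
  {ae mu, forall x, f1 x = f2 x} ->
  scalar_integral mu f1 = scalar_integral mu f2.
Proof.
case: k f1 f2 => /= f1 f2 e; first exact: ae_eq_Rintegral_nonmeasurable.
by congr Complex; apply: ae_eq_Rintegral_nonmeasurable;
  apply: filterS e => x ->.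
Qed.

End AeEqIntegral.

Section L2.
Context {R : realType} {G : compactGroupType} (mu : haar_measure R G).
Context {k : scalar_kind} (H : hilbertType R k).

(* Square-integrable Borel functions; L^2 is their quotient by almost everywhere
   equality. *)
Record square_integrable := SquareIntegrable {
  sqi_fun :> G -> H ;
  sqi_measurable : measurable_fun [set: borel G] (sqi_fun : borel G -> borel H) ;
  sqi_finite : (\int[mu]_g ((hnorm (sqi_fun g)) ^+ 2)%:E < +oo)%E
}.

HB.instance Definition _ := gen_eqMixin square_integrable.
HB.instance Definition _ := gen_choiceMixin square_integrable.

Definition ae_eqb (f1 f2 : square_integrable) : bool :=
  `[< {ae mu, forall g : borel G, f1 g = f2 g} >].

Let ae_eqb_refl : reflexive ae_eqb.
Proof. by move=> f; apply/asboolP; exact: aeW. Qed.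

Let ae_eqb_sym : symmetric ae_eqb.
Proof.
by move=> f1 f2; apply/asboolP/asboolP => e; apply: filterS e => x ->.
Qed.

Let ae_eqb_trans : transitive ae_eqb.
Proof.
move=> f2 f1 f3 /asboolP e12 /asboolP e23; apply/asboolP.
by apply: filterS2 e12 e23 => x -> ->.
Qed.

Canonical ae_eqb_equiv := EquivRel ae_eqb ae_eqb_refl ae_eqb_sym ae_eqb_trans.

Local Open Scope quotient_scope.

Definition L2 : Type := {eq_quot ae_eqb}.
HB.instance Definition _ := Choice.on L2.
HB.instance Definition _ := EqQuotient.on L2.

Lemma L2_eqP (f1 f2 : square_integrable) :
  \pi_L2 f1 = \pi_L2 f2 <-> {ae mu, forall g : borel G, f1 g = f2 g}.
Proof. by split=> [/eqmodP/asboolP|e]//; apply/eqmodP/asboolP. Qed.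

Lemma L2_reprP (f : square_integrable) :
  {ae mu, forall g : borel G, (repr (\pi_L2 f) : square_integrable) g = f g}.
Proof. by apply/L2_eqP; rewrite reprK. Qed.

(* On functions rather than on classes, so that it applies to the difference of
   two elements of L^2. *)
Definition L2inner (f1 f2 : G -> H) : scalars R k :=
  scalar_integral mu (fun g => inner (f1 g) (f2 g)).

(* ||u - v|| = sqrt <u - v, u - v> *)
Definition L2dist (u v : L2) : R :=
  let w := fun g => (repr u : square_integrable) g
                    - (repr v : square_integrable) g in
  Num.sqrt (scalar_re (L2inner w w)).

Lemma L2dist_pi (f1 f2 : square_integrable) :
  L2dist (\pi_L2 f1) (\pi_L2 f2) =
  Num.sqrt (scalar_re (L2inner (fun g => f1 g - f2 g) (fun g => f1 g - f2 g))).
Proof.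
rewrite /L2dist /L2inner; congr (Num.sqrt (scalar_re _)).
apply: ae_eq_scalar_integral.
by apply: filterS2 (L2_reprP f1) (L2_reprP f2) => g -> ->.
Qed.

Let rmul (g : G) : borel G -> borel G := fun h => (h * g)%g.

Let rmul_measurable g : measurable_fun [set: borel G] (rmul g).
Proof.
apply: (@continuous_borel_measurable G G) => h.
apply: (@continuous_comp G (G * G)%type G (fun h => (h, g))
  (fun p => (p.1 * p.2)%g)).
  by apply: cvg_pair => /=; [exact: cvg_id|exact: cvg_cst].
exact: mulg_continuous.
Qed.

Let preimage_rmul g (A : set G) : rmul g @^-1` A = [set (h * g^-1)%g | h in A].
Proof.
apply/seteqP; split=> [h /= Ahg|_ [h Ah <-]]; last by rewrite /rmul /= mulgVK.
by exists (h * g)%g; rewrite ?mulgK.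
Qed.

Let haar_preimage_rmul g (A : set (borel G)) : measurable A ->
  mu (rmul g @^-1` A) = mu A.
Proof. by move=> mA; rewrite preimage_rmul haar_right_invariant. Qed.

Let translate_measurable (f : square_integrable) g :
  measurable_fun [set: borel G] ((fun h => f (h * g)%g) : borel G -> borel H).
Proof.
exact: (measurableT_comp (@sqi_measurable f) (rmul_measurable g)).
Qed.

Let translate_finite (f : square_integrable) g :
  (\int[mu]_h ((hnorm (f (h * g)%g)) ^+ 2)%:E < +oo)%E.
Proof.
have mf : measurable_fun [set: borel G]
    (fun h : borel G => ((hnorm (f h)) ^+ 2)%:E).
  apply/measurable_EFinP/measurable_funX.
  exact: (measurableT_comp
    (continuous_real_measurable (@hnorm_continuous R k H)) (sqi_measurable f)).
apply: le_lt_trans (sqi_finite f).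
rewrite -[leLHS](@ge0_integral_pushforward _ _ _ _ _ _ (rmul_measurable g) mu
  setT (fun h => ((hnorm (f h)) ^+ 2)%:E))//; last first.
  by move=> h _; rewrite lee_fin sqr_ge0.
rewrite (eq_measure_integral mu)// => A mA _.
exact: haar_preimage_rmul.
Qed.

(* h |-> f (h g) *)
Definition translate (g : G) (f : square_integrable) : square_integrable :=
  SquareIntegrable (translate_measurable f g) (translate_finite f g).

Definition L2act (g : G) (u : L2) : L2 := \pi_L2 (translate g (repr u)).

Lemma L2act_pi g f : L2act g (\pi_L2 f) = \pi_L2 (translate g f).
Proof.
apply/L2_eqP => /=; have [N [mN N0 subN]] := L2_reprP f.
exists (rmul g @^-1` N); split.
- by rewrite -[X in measurable X]setTI; exact: rmul_measurable.
- by rewrite haar_preimage_rmul.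
- by move=> h /= fh; apply: subN.
Qed.

End L2.

Arguments L2dist {R G mu k H} u v.
Arguments translate {R G mu k H} g f.
Arguments L2act {R G mu k H} g u.

(* Main.v *)
Require Import Defs.
From HB Require Import structures.
From mathcomp Require Import all_boot all_order all_algebra.
From mathcomp Require Import all_classical all_reals all_analysis.
From mathcomp.real_closed Require Import complex.

Set Implicit Arguments.
Unset Strict Implicit.
Unset Printing Implicit Defensive.

Import Order.TTheory GRing.Theory Num.Theory.
Import numFieldNormedType.Exports.
Local Open Scope classical_set_scope.
Local Open Scope ring_scope.
Local Open Scope quotient_scope.

(* If phi has finite distortion then it is Lipschitz, so each orbit map
   g |-> phi (g x) is continuous, hence Borel and bounded on the compact group G,
   and psi x is its class in L^2.  Since G acts by isometries, the integrand
   ||phi (g x) - phi (g y)||^2 of the squared distance from psi x to psi y lies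
   between (alpha d(x, y))^2 and (beta d(x, y))^2, and the Haar measure has mass
   one.  If phi has infinite distortion, psi = 0 will do. *)

(** Enlarging the sets of admissible constants raises the supremum and lowers the infimum. This
    reduces (b) to checking one constant at a time. *)
Lemma le_distortion (R : realType) (X Y Z : Type) (dX : X -> X -> R)
    (dY : Y -> Y -> R) (dZ : Z -> Z -> R) (f : X -> Y) (h : X -> Z) :
  (forall y y', 0 <= dY y y') ->
  is_lower_constant dX dY f `<=` is_lower_constant dX dZ h ->
  is_upper_constant dX dY f `<=` is_upper_constant dX dZ h ->
  (distortion dX dZ h <= distortion dX dY f)%E.
Proof.
move=> dY_ge0 sub_lower sub_upper.
have le_lower : (lower_constant dX dY f <= lower_constant dX dZ h)%E.
  exact: ereal_sup_le.
have le_upper : (upper_constant dX dZ h <= upper_constant dX dY f)%E.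
  exact: ereal_inf_le_tmp.
rewrite {2}/distortion; case: ifPn => [_|]; first by rewrite leey.
rewrite negb_or -ltey => /andP[lower_f0 upper_fy].
have lower_f_ge0 : (0 <= lower_constant dX dY f)%E.
  apply: ereal_sup_ubound; split => // x x'.
  by rewrite mul0e lee_fin.
have lower_f_gt0 : (0 < lower_constant dX dY f)%E by rewrite lt0e lower_f0.
have lower_h_gt0 := lt_le_trans lower_f_gt0 le_lower.
(* The bounds on the constants of [h] rule out the infinite branch, leaving a comparison of two
   quotients. *)
rewrite /distortion gt_eqF//= lt_eqF ?(le_lt_trans le_upper)//.
apply: lee_pmul => //.
- by apply: le_ereal_inf_tmp => b [].
- by rewrite inve_ge0 ltW.
- by rewrite lee_pV2// inE ltW.
Qed.

Lemma scalar_re_sqr_norm (R : realType) k (x : scalars R k) : 0 <= x ->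
  scalar_re (x ^+ 2) = scalar_re x ^+ 2.
Proof.
case: k x => //= -[a b]; rewrite lecE /= => /andP[/eqP -> _].
by rewrite expr2 /= mulr0 subr0.
Qed.

(** Nonnegative complex numbers have zero imaginary part, so their order is that of their real
    parts. This carries real estimates back to the norm of [H]. *)
Lemma normr_lt_hnorm (R : realType) k (H : hilbertType R k) (v : H)
    (e : scalars R k) : 0 < e -> hnorm v < scalar_re e -> `|v| < e.
Proof.
rewrite /hnorm; move: (normr_ge0 v); case: k H v e => /= H v e //.
case: `|v| e => [a b] [c d].
by rewrite !ltcE !lecE /= => /andP[/eqP -> _] /andP[/eqP -> _] ->; rewrite eqxx.
Qed.

Lemma scalar_re_gt0 (R : realType) k (x : scalars R k) : 0 < x -> 0 < scalar_re x.
Proof. by case: k x => //= x; rewrite ltcE => /andP[]. Qed.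

Lemma scalar_re_L2inner (R : realType) (G : compactGroupType)
    (mu : haar_measure R G) k (H : hilbertType R k) (w : G -> H) :
  scalar_re (L2inner mu w w) = \int[mu]_g (hnorm (w g) ^+ 2).
Proof.
transitivity (\int[mu]_g scalar_re (inner (w g) (w g))).
  (* Once [k] is known, the real part of the scalar integral is by definition the integral of the
     real part. *)
  by rewrite /L2inner; case: k H w.
apply: eq_Rintegral => g _.
by rewrite inner_normE scalar_re_sqr_norm.
Qed.

Section ContinuousOnCompactGroup.
Context (R : realType) (G : compactGroupType) (mu : haar_measure R G).

(** By compactness [f] is bounded, and the measure is finite. *)
Lemma continuous_integrable (f : G -> R) : continuous f ->
  mu.-integrable [set: borel G] (EFin \o f).
Proof.
move=> cf; apply: measurable_bounded_integrable => //.
- exact: le_lt_trans (probability_le1 mu measurableT) (ltry 1).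
- exact: continuous_real_measurable.
- have : bounded_set (f @` [set: G]).
    apply/compact_bounded/continuous_compact; last exact: compact_setT.
    exact: (@continuous_subspaceT G R setT f cf).
  by case=> M [Mreal fM]; exists M; split=> // N /fM fN g _; apply: fN; exists g.
Qed.

Lemma haar_Rintegral_cst (c : R) : \int[mu]_g c = c.
Proof.
rewrite Rintegral_cst// -[RHS]mulr1; congr (_ * _).
exact: (congr1 fine (probability_setT mu)).
Qed.

Context (k : scalar_kind) (H : hilbertType R k).

Lemma continuous_sqr_hnorm (f : G -> H) : continuous f ->
  continuous (fun g => hnorm (f g) ^+ 2).
Proof.
move=> cf g; apply: (@continuous_comp _ _ _ (fun g => hnorm (f g))
  (fun x => x ^+ 2)).
  by apply: continuous_comp; [exact: cf|exact: hnorm_continuous].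
exact: exprn_continuous.
Qed.

Lemma continuous_sqr_hnorm_lty (f : G -> H) : continuous f ->
  (\int[mu]_g (hnorm (f g) ^+ 2)%:E < +oo)%E.
Proof.
by move=> /continuous_sqr_hnorm/continuous_integrable; exact: integrable_lty.
Qed.

Definition sqi_of_continuous (f : G -> H) (cf : continuous f) :
    square_integrable mu H :=
  SquareIntegrable (@continuous_borel_measurable G H f cf)
    (continuous_sqr_hnorm_lty cf).

Lemma L2dist_continuous_bounds (f1 f2 : G -> H) (cf1 : continuous f1)
    (cf2 : continuous f2) (m M : R) :
  0 <= m -> 0 <= M -> (forall g, m <= hdist (f1 g) (f2 g) <= M) ->
  m <= L2dist (\pi_(L2 mu H) (sqi_of_continuous cf1))
              (\pi_(L2 mu H) (sqi_of_continuous cf2)) <= M.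
Proof.
move=> m0 M0 bounds; rewrite L2dist_pi scalar_re_L2inner /=.
have sqr_int := continuous_integrable (continuous_sqr_hnorm
  (fun g => continuousB (cf1 g) (cf2 g))).
have cst_int (c : R) := continuous_integrable (@cst_continuous G R c).
apply/andP; split.
(* Write [m] as the square root of the integral of the constant [m ^+ 2], the total mass being one,
   and compare integrands. *)
- rewrite -[leLHS](ger0_norm m0) -sqrtr_sqr ler_wsqrtr//.
  rewrite -[leLHS]haar_Rintegral_cst.
  apply: le_Rintegral => // g _.
  by case/andP: (bounds g) => mg _; rewrite ler_pXn2r ?nnegrE ?hnorm_ge0.
- rewrite -[leRHS](ger0_norm M0) -sqrtr_sqr ler_wsqrtr//.
  rewrite -[leRHS]haar_Rintegral_cst.
  apply: le_Rintegral => // g _.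
  by case/andP: (bounds g) => _ gM; rewrite ler_pXn2r ?nnegrE ?hnorm_ge0.
Qed.

End ContinuousOnCompactGroup.

Lemma lipschitz_continuous (R : realType) k (X : metricType R)
    (H : hilbertType R k) (phi : X -> H) (b : R) : 0 <= b ->
  (forall x y, hdist (phi x) (phi y) <= b * mdist x y) -> continuous phi.
Proof.
move=> b0 lip x; apply/cvgrPdist_lt => e e0.
(* Dividing by [b + 1] covers the case [b = 0]. *)
have b1 : 0 < b + 1 by rewrite ltr_wpDl.
have d0 : 0 < scalar_re e / (b + 1) by rewrite divr_gt0// scalar_re_gt0.
have near_x := metricType_numDomainType.cvgr_dist_lt (@cvg_id _ (nbhs x)) d0.
apply: filterS (near_x _) => y; rewrite ltr_pdivlMr// => xy.
apply: normr_lt_hnorm => //; apply: le_lt_trans (lip x y) (le_lt_trans _ xy).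
by rewrite mulrC ler_wpM2l ?mdist_ge0// lerDl.
Qed.

Lemma orbit_continuous (R : realType) (G : topologicalGroupType)
    (X : metricType R) (a : isometric_action G X) (x : X) :
  continuous (fun g => a g x).
Proof.
move=> g; apply: (@continuous_comp _ _ _ (fun h => (h, x)) (fun p => a p.1 p.2)).
  by apply: cvg_pair => /=; [exact: cvg_id|exact: cvg_cst].
exact: act_continuous.
Qed.

Theorem lemma4 (R : realType) (k : scalar_kind) (X : metricType R)
    (G : compactGroupType) (a : isometric_action G X) (H : hilbertType R k)
    (phi : X -> H) (mu : haar_measure R G) :
  exists psi : X -> L2 mu H,
    (forall g : G, psi \o a g = L2act g \o psi) /\
    (distortion mdist L2dist psi <= distortion mdist hdist phi)%E.
Proof.
have [phi_y|] := eqVneq (distortion mdist hdist phi) +oo%E.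
  (* The zero class is fixed by every translation. *)
  exists (fun=> \pi_(L2 mu H) (sqi_of_continuous mu (@cst_continuous G H 0))).
  split=> [g|]; last by rewrite phi_y leey.
  by apply/funext => x /=; rewrite L2act_pi; apply/L2_eqP/aeW.
rewrite {1}/distortion; case: ifPn => [_ /eqP//|].
rewrite negb_or => /andP[_ upper_y] _.
(* The upper constant is attained and finite here, so its real value is a Lipschitz constant of
   [phi]. *)
have [b b0 lip] : exists2 b : R, 0 <= b &
    forall x y, hdist (phi x) (phi y) <= b * mdist x y.
  have [] : is_upper_constant mdist hdist phi (upper_constant mdist hdist phi).
    apply: upper_constantP => [x y|x y /mdist_positivity -> //|v].
    - exact: mdist_ge0.
    - by rewrite /hdist subrr /hnorm normr0; case: k H phi {upper_y} v.
  case: (upper_constant _ _ _) upper_y => // b _ b0 lip.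
  by exists b => // x y; rewrite -lee_fin EFinM.
have cphi x : continuous (fun g => phi (a g x)).
  move=> g; apply: (@continuous_comp _ _ _ (fun g => a g x) phi).
    exact: orbit_continuous.
  exact: lipschitz_continuous lip _.
exists (fun x => \pi_(L2 mu H) (sqi_of_continuous mu (cphi x))); split=> [g|].
  (* At [h] the two sides are [phi (a h (a g x))] and [phi (a (h * g) x)]. *)
  apply/funext => x /=; rewrite L2act_pi; apply/L2_eqP/aeW => h /=.
  by rewrite actM.
apply: le_distortion => [u v|c [c0 lower]|c [c0 upper]].
- exact: hnorm_ge0.
- split=> // x y; have d0 : (0 <= (mdist x y)%:E)%E by rewrite lee_fin mdist_ge0.
  have lower_orbit g :
      (c * (mdist x y)%:E <= (hdist (phi (a g x)) (phi (a g y)))%:E)%E.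
    by rewrite -(act_isometry a g); exact: lower.
  move: (mule_ge0 c0 d0) lower_orbit.
  (* The constant [c] may be [+oo], but its product with the distance is finite, being at most the
     real distance between the values of [phi] at [a 1 x] and [a 1 y]. *)
  case: (c * _)%E => [m||] // m0 lower_orbit; last by have := lower_orbit 1%g.
  rewrite lee_fin in m0 *.
  (* The Lipschitz bound supplies the upper half of the two-sided estimate. *)
  have bounds g : m <= hdist (phi (a g x)) (phi (a g y)) <= b * mdist x y.
    by rewrite -lee_fin lower_orbit /= -(act_isometry a g).
  by have /andP[] := L2dist_continuous_bounds mu (cphi x) (cphi y) m0
    (mulr_ge0 b0 (mdist_ge0 x y)) bounds.
- split=> // x y; have d0 : (0 <= (mdist x y)%:E)%E by rewrite lee_fin mdist_ge0.
  have upper_orbit g :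
      ((hdist (phi (a g x)) (phi (a g y)))%:E <= c * (mdist x y)%:E)%E.
    by rewrite -(act_isometry a g); exact: upper.
  move: (mule_ge0 c0 d0) upper_orbit.
  (* If the product is [+oo], the bound is trivial. *)
  case: (c * _)%E => [M||] // M0 upper_orbit; last by rewrite leey.
  rewrite lee_fin in M0 *.
  have bounds g : 0 <= hdist (phi (a g x)) (phi (a g y)) <= M.
    by apply/andP; split; [exact: hnorm_ge0|rewrite -lee_fin; exact: upper_orbit].
  by have /andP[] := L2dist_continuous_bounds mu (cphi x) (cphi y) (lexx 0) M0
    bounds.
Qed.
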